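(* Let $k\ge 3$ and $n\geq 2k+1$. Let $S$ be a vertex cut of $K(n,k)$ and $c=c(K(n,k)\setminus S)$. Then either $$\binom{n-k-1}{k-1}+1\leq c\leq \binom{n-1}{k-1}-\binom{n-k-1}{k-1}+1,$$ or $$\frac{|S|}{c}\geq \frac{n}{k}-1,$$ with equality in the latter if and only if $S$ is the complement of a maximum independent set of $K(n,k)$.
   Context: The Kneser graph $K(n,k)$ has as vertices the $k$-element subsets of $[n]=\{1,\dots,n\}$, two vertices being adjacent iff they are disjoint. A vertex cut is a set $S$ of vertices whose removal disconnects the graph; $c(G\setminus S)$ is the number of connected components after deleting $S$. *)

(* Defs.v *)
From HB Require Import structures.
From mathcomp Require Import all_boot all_order all_algebra.
Unset Strict Implicit. Unset Printing Implicit Defensive.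

Definition kverts (n k : nat) : {set {set 'I_n}} := [set A : {set 'I_n} | #|A| == k].

Definition kneser_adj (n : nat) (A B : {set 'I_n}) : bool := [disjoint A & B].

Definition induced_rel (n : nat) (R : {set {set 'I_n}}) : rel {set 'I_n} :=
  fun A B => [&& A \in R, B \in R & kneser_adj n A B].

Definition ncomp_del (n k : nat) (S : {set {set 'I_n}}) : nat :=
  n_comp (induced_rel n (kverts n k :\: S)) (kverts n k :\: S).

Definition vertex_cut (n k : nat) (S : {set {set 'I_n}}) : Prop :=
  S \subset kverts n k /\ 2 <= ncomp_del n k S.

Definition independent (n k : nat) (I : {set {set 'I_n}}) : Prop :=
  I \subset kverts n k /\
  {in I &, forall A B, A != B -> ~~ kneser_adj n A B}.

Definition max_independent (n k : nat) (I : {set {set 'I_n}}) : Prop :=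
  independent n k I /\ forall J, independent n k J -> #|J| <= #|I|.

(* Main.v *)
Require Import Defs.
From mathcomp Require Import all_boot all_order all_algebra.
From mathcomp Require Import perm zify.
Import Order.TTheory GRing.Theory Num.Theory.

(** One vertex from each component of K(n,k) \ S gives an intersecting family of
    size c. If c exceeds the Hilton-Milner bound, every such transversal is a star.
    Two adjacent vertices A, B in one component would give transversals centred at
    some x in A and some y in B, so the c - 1 other representatives would contain
    both x and y, which is too few sets; hence K(n,k) \ S is independent and
    |S|/c = (C(n,k) - c)/c is controlled by the Erdos-Ko-Rado theorem.
    If c <= C(n-k-1,k-1), it suffices that |S| >= d = C(n-k,k), strictly if c >= 3,
    because d/C(n-k-1,k-1) = n/k - 1. This holds because K(n,k) is
    super-connected: a set of vertices whose boundary leaves at least two vertices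
    on both sides has boundary larger than d. In a smallest counterexample F
    (boundary first, then size), submodularity shows that a translate of F by a
    permutation of the points equals F, is disjoint from F, or meets F in one
    vertex v with N[F] and N[gF] meeting exactly in N[v]; transpositions
    moving one neighbour of v in F to a neighbour outside F exclude this.
    The Hilton-Milner theorem is proved by shifting points into a 2k-set Y, so that
    all traces on Y meet, and by induction on k for the traces of size < k. *)

(** * The Hilton-Milner theorem *)

Section SetFamilies.

Context {T : finType}.
Implicit Types (E Y I A B D : {set T}) (F G : {set {set T}}) (i j x : T).

Definition ksets E k := [set A : {set T} | A \subset E & #|A| == k].

Definition intersecting F := [forall A in F, forall B in F, A :&: B != set0].

Definition nontrivial F := [forall x, exists A in F, x \notin A].

Lemma intersectingP F :
  reflect {in F &, forall A B, A :&: B != set0} (intersecting F).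
Proof.
apply: (iffP forall_inP) => [H A B FA FB | H A FA].
  by move/forall_inP: (H A FA); apply.
by apply/forall_inP => B FB; apply: H.
Qed.

Lemma nontrivialP F :
  reflect (forall x, exists2 A, A \in F & x \notin A) (nontrivial F).
Proof.
apply: (iffP forallP) => H x; first by have /exists_inP := H x.
by apply/exists_inP; apply: H.
Qed.

Lemma nontrivialPn F :
  reflect (exists x, {in F, forall A, x \in A}) (~~ nontrivial F).
Proof.
apply: (iffP forallPn) => -[x Hx]; exists x.
  by move=> A FA; apply: contraNT Hx => xA; apply/exists_inP; exists A.
by apply/exists_inP => -[A FA /negP[]]; apply: Hx.
Qed.

Lemma mem_ksets E k A : (A \in ksets E k) = (A \subset E) && (#|A| == k).
Proof. by rewrite inE. Qed.

Lemma card_ksets E k : #|ksets E k| = 'C(#|E|, k).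
Proof. exact: cards_draws. Qed.

Lemma card_ksets_sup E D k : D \subset E -> #|D| <= k ->
  #|[set A in ksets E k | D \subset A]| = 'C(#|E| - #|D|, k - #|D|).
Proof.
move=> DE Dk.
have <- : #|E :\: D| = #|E| - #|D| by rewrite cardsD (setIidPr DE).
rewrite -card_ksets.
have dis B : B \subset E :\: D -> D :&: B = set0.
  by rewrite subsetD disjoint_sym -setI_eq0 => /andP[_ /eqP].
have <- : [set D :|: B | B in ksets (E :\: D) (k - #|D|)] =
          [set A in ksets E k | D \subset A].
  apply/setP => A; rewrite inE mem_ksets; apply/imsetP/idP.
    move=> [B]; rewrite mem_ksets => /andP[BE /eqP cB] ->.
    rewrite subsetUl subUset DE cardsU dis // cards0 cB subn0 subnKC // eqxx.
    by rewrite (subset_trans BE (subsetDl _ _)).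
  case/andP=> /andP[AE /eqP cA] DA; exists (A :\: D).
    by rewrite mem_ksets setSD //= cardsD (setIidPr DA) cA.
  by rewrite -{1}(setIidPr DA) setID.
apply: card_in_imset => B C; rewrite !mem_ksets => /andP[BE _] /andP[CE _] eBC.
have get (X : {set T}) : X \subset E :\: D -> (D :|: X) :\: D = X.
  by move=> XE; rewrite setDUl setDv set0U; apply/setDidPl; rewrite disjoint_sym;
     rewrite -setI_eq0 dis.
by rewrite -(get B BE) eBC get.
Qed.

(** * Shifting a family of sets *)

Definition exchange i j A := i |: (A :\ j).

(** A set moves only to a place not yet taken in [F], which keeps the map injective on [F]. *)
Definition shift1 i j F A :=
  if [&& j \in A, i \notin A & exchange i j A \notin F]
  then exchange i j A else A.

Definition shift i j F := [set shift1 i j F A | A in F].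

Lemma card_exchange i j A : j \in A -> i \notin A -> #|exchange i j A| = #|A|.
Proof.
move=> jA iA; rewrite cardsU1 (cardsD1 j A) jA !inE (negPf iA) andbF.
by [].
Qed.

Lemma shift1_inj i j F : {in F &, injective (shift1 i j F)}.
Proof.
move=> A B FA FB; rewrite /shift1; case: ifPn => [/and3P[jA iA nA]|_].
  case: ifPn => [/and3P[jB iB nB] e | _ e]; last by rewrite e FB in nA.
  have rec (C : {set T}) : j \in C -> i \notin C -> C = j |: (exchange i j C :\ i).
    move=> jC iC; apply/setP => x; rewrite !inE.
    have [->|xj] := eqVneq x j; first by rewrite jC.
    by have [->|xi] := eqVneq x i; first by rewrite (negPf iC).
  by rewrite (rec A) // (rec B) // e.
by case: ifPn => [/and3P[jB iB nB] e | _ //]; rewrite -e FA in nB.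
Qed.

Lemma card_shift i j F : #|shift i j F| = #|F|.
Proof. exact/card_in_imset/shift1_inj. Qed.

Lemma shift_ksets i j E k F :
  i \in E -> F \subset ksets E k -> shift i j F \subset ksets E k.
Proof.
move=> iE /subsetP FE; apply/subsetP => _ /imsetP[A FA ->]; rewrite /shift1.
case: ifPn => [/and3P[jA iA _]|_]; last exact: FE.
have := FE A FA; rewrite !mem_ksets card_exchange // => /andP[AE ->].
by rewrite subUset sub1set iE (subset_trans (subsetDl _ _)).
Qed.

(** A moved set contains [i], so the one dangerous pair is a moved [A] and an unmoved [B] that meet
    only in [j]. If [i] is in [B], they meet in [i]; otherwise [exchange i j B] lies in [F] and
    would be disjoint from [A]. *)
Lemma shift_intersecting i j F : intersecting F -> intersecting (shift i j F).
Proof.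
move=> /intersectingP FI; apply/intersectingP.
have main A B : A \in F -> B \in F -> j \in A -> i \notin A ->
    ~~ [&& j \in B, i \notin B & exchange i j B \notin F] ->
    exchange i j A :&: B != set0.
  move=> FA FB jA iA nB.
  case: (set_0Vmem ((A :&: B) :\ j)) => [e | [x]]; last first.
    rewrite !inE => /and3P[xj xA xB]; apply/set0Pn; exists x.
    by rewrite !inE xj xA xB orbT.
  have jB : j \in B.
    have /set0Pn[x xAB] := FI A B FA FB.
    have [<-|xj] := eqVneq x j; first by case/setIP: xAB.
    by have : x \in (A :&: B) :\ j; [rewrite !inE xj -in_setI | rewrite e inE].
  have [iB|iB] := boolP (i \in B).
    by apply/set0Pn; exists i; rewrite !inE eqxx iB.
  move: nB; rewrite jB iB /= negbK => FB'.
  have /set0Pn[x] := FI _ _ FA FB'; rewrite !inE => /andP[xA].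
  case/orP=> [/eqP xi|/andP[xj xB]]; first by rewrite -xi xA in iA.
  by have : x \in (A :&: B) :\ j; [rewrite !inE xj xA | rewrite e inE].
move=> _ _ /imsetP[A FA ->] /imsetP[B FB ->]; rewrite /shift1.
case: ifPn => [/and3P[jA iA nA]|nA]; case: ifPn => [/and3P[jB iB nB]|nB].
- by apply/set0Pn; exists i; rewrite !inE eqxx.
- exact: main.
- by rewrite setIC; apply: main.
- exact: FI.
Qed.

(** Potential function: a family of maximal weight admits no further proper shift from outside [Y]
    into [Y]. *)
Definition weight Y F := \sum_(A in F) #|A :&: Y|.

Lemma weight_shift i j Y F A : i \in Y -> j \notin Y ->
  A \in F -> j \in A -> i \notin A -> exchange i j A \notin F ->
  weight Y F < weight Y (shift i j F).
Proof.
move=> iY jY FA jA iA nA; rewrite /weight /shift.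
rewrite (big_imset _ (shift1_inj i j F)) /= (bigD1 A) //= [ltnRHS](bigD1 A) //=.
have ex B : i \notin B -> #|exchange i j B :&: Y| = #|B :&: Y|.+1.
  move=> iB; have -> : exchange i j B :&: Y = i |: (B :&: Y).
    apply/setP => x; rewrite !inE; case: (eqVneq x i) => [->|_] //=.
    by case: (eqVneq x j) => [->|_] //=; rewrite (negPf jY) andbF.
  by rewrite cardsU1 !inE (negPf iB).
rewrite -addSn leq_add //; first by rewrite /shift1 jA iA nA /= ex.
apply: leq_sum => B _; rewrite /shift1.
by case: ifPn => // /and3P[_ iB _]; rewrite ex.
Qed.

Definition stable I Y F := forall i j A, i \in I -> j \notin Y -> A \in F ->
  j \in A -> i \notin A -> exchange i j A \in F.

(* If A and B do not meet in Y, exchanging a common point of A and B for a point of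
   I outside both gives a smaller intersection. *)
Lemma stable_meet I Y F : I \subset Y -> intersecting F -> stable I Y F ->
  (forall A B j, A \in F -> B \in F -> j \notin Y -> j \in A -> j \in B ->
     ~~ (I \subset A :|: B)) ->
  {in F &, forall A B, A :&: B :&: Y != set0}.
Proof.
move=> IY /intersectingP FI st big A B; have [m] := ubnP #|A :&: B|.
elim: m A B => // m IHm A B mAB FA FB.
apply/negP => e0.
have /set0Pn[j] := FI A B FA FB; rewrite inE => /andP[jA jB].
have jY : j \notin Y.
  apply/negP => jY; have : j \in A :&: B :&: Y by rewrite !inE jA jB.
  by rewrite (eqP e0) inE.
have /subsetPn[i iI] := big A B j FA FB jY jA jB.
rewrite inE negb_or => /andP[iA iB].
have FA' := st i j A iI jY FA jA iA.
have sub : exchange i j A :&: B \subset (A :&: B) :\ j.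
  apply/subsetP => x; rewrite !inE => /andP[/orP[/eqP->|/andP[-> ->]] xB] //.
  by rewrite xB in iB.
have lt : #|exchange i j A :&: B| < m.
  move: mAB; rewrite (cardsD1 j (A :&: B)) inE jA jB /= ltnS.
  by apply: leq_ltn_trans; apply: subset_leq_card.
have /set0Pn[x] := IHm _ _ lt FA' FB.
rewrite inE => /andP[/(subsetP sub)]; rewrite inE => /andP[_ xAB] xY.
by have := in_set0 x; rewrite -(eqP e0) inE xAB xY.
Qed.

(** * Counting a family by its traces on a fixed set *)

Definition traces Y F := [set A :&: Y | A in F].

(** A member with trace [B] on [Y] is determined by its remaining [k - #|B|] points outside [Y]. *)
Lemma trace_count E Y F k : Y \subset E -> F \subset ksets E k ->
  #|F| <= \sum_(i < k.+1) #|[set B in traces Y F | #|B| == i]| * 'C(#|E| - #|Y|, k - i).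
Proof.
move=> YE /subsetP FE.
have cardT B : B \in traces Y F -> B \subset Y /\ #|B| < k.+1.
  case/imsetP=> A /FE; rewrite mem_ksets => /andP[_ /eqP <-] ->.
  by rewrite subsetIr ltnS subset_leq_card ?subsetIl.
rewrite -sum1_card (partition_big_imset (fun A => A :&: Y)) /=.
apply: (@leq_trans (\sum_(B in traces Y F) 'C(#|E| - #|Y|, k - #|B|))).
  apply: leq_sum => B /cardT[BY Bk]; rewrite sum1dep_card.
  have BE : B \subset E :\: (Y :\: B).
    rewrite subsetD (subset_trans BY YE) /= -setI_eq0 setIDA -subset0.
    by apply/subsetP => x; rewrite !inE => /andP[/negPf->].
  have -> : #|E| - #|Y| = #|E :\: (Y :\: B)| - #|B|.
    rewrite cardsD (setIidPr (subset_trans (subsetDl _ _) YE)) cardsD (setIidPr BY).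
    by have := subset_leq_card BY; have := subset_leq_card YE; lia.
  rewrite -card_ksets_sup //.
  apply/subset_leq_card/subsetP => A; rewrite !inE => /andP[FA /eqP <-].
  have := FE A FA; rewrite mem_ksets subsetIl andbT => /andP[AE ->].
  rewrite andbT subsetD AE -setI_eq0 -subset0.
  by apply/subsetP => x; rewrite !inE => /and3P[->]; case: (x \in Y).
rewrite (partition_big (fun B => inord #|B| : 'I_k.+1) predT) //=.
apply: leq_sum => i _; rewrite -sum1dep_card big_distrl /=.
apply: eq_leq; apply: eq_big => [B|B /andP[/cardT[_ Bk] /eqP <-]].
  apply: andb_id2l => /cardT[_ Bk].
  by rewrite -val_eqE /= inordK.
by rewrite mul1n inordK.
Qed.

(** The size of the extremal family: one [k]-set [B] and all [k]-sets through a fixed point outside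
    [B] that meet [B]. *)
Definition hilton_milner_bound m k := 'C(m - 1, k - 1) - 'C(m - k - 1, k - 1) + 1.

(** The ground set varies because the induction applies smaller cases inside [Y]. *)
Definition hilton_milner_at k := forall E F, 2 * k <= #|E| -> F \subset ksets E k ->
  intersecting F -> nontrivial F -> #|F| <= hilton_milner_bound #|E| k.

(* If the traces of size m share a point x, they must still meet a member of F that
   misses x; otherwise the Hilton-Milner bound for m < k applies to them. *)
Lemma trace_bound Y F E k m : (forall l, l < k -> hilton_milner_at l) -> F \subset ksets E k ->
  nontrivial F -> #|Y| = 2 * k ->
  {in F &, forall A B, A :&: B :&: Y != set0} -> 0 < m < k ->
  #|[set B in traces Y F | #|B| == m]| + 'C(k - 1, m - 1) <= 'C(2 * k - 1, m - 1).
Proof.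
move=> IH /subsetP FE nt cY meet /andP[m0 mk].
set A := [set B in _ | _].
have AY : A \subset ksets Y m.
  by apply/subsetP => _ /setIdP[/imsetP[B _ ->] cB]; rewrite mem_ksets subsetIr.
have AI : intersecting A.
  apply/intersectingP => _ _ /setIdP[/imsetP[B FB ->] _] /setIdP[/imsetP[C FC ->] _].
  by rewrite setIACA setIid meet.
have mono : 'C(k - 1, m - 1) <= 'C(2 * k - 1, m - 1) by apply: leq_bin2l; lia.
have star x : {in A, forall B, x \in B} ->
    #|A| + 'C(k - 1, m - 1) <= 'C(2 * k - 1, m - 1).
  move=> Ax; case: (set_0Vmem A) => [->|[B0 AB0]]; first by rewrite cards0.
  have xY : x \in Y.
    have := Ax _ AB0; apply/subsetP.
    by move/subsetP: AY => /(_ _ AB0); rewrite mem_ksets => /andP[].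
  (* The [m]-subsets of [Y] through [x] that avoid [G] cannot be traces, and at least [k] points of
     [Y] lie outside [G]. *)
  have [G FG xG] := nontrivialP F nt x.
  have cG : #|Y :\: G| >= k.
    have := FE G FG; rewrite mem_ksets => /andP[_ /eqP cG].
    rewrite cardsD cY; have := subset_leq_card (subsetIr Y G); lia.
  have bigger : 'C(k - 1, m - 1) <= 'C(#|Y :\: G| - 1, m - 1).
    by apply: leq_bin2l; lia.
  have xYG : [set x] \subset Y :\: G by rewrite sub1set inE xG.
  have c1 := card_ksets_sup Y [set x] m; rewrite sub1set cards1 cY in c1.
  have c2 := card_ksets_sup _ [set x] m xYG; rewrite cards1 in c2.
  rewrite -c1 //; apply: leq_trans (leq_add (leqnn _) bigger) _; rewrite -c2 //.
  rewrite -cardsUI.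
  set S2 := [set _ in ksets (Y :\: G) m | _].
  have -> : A :&: S2 = set0.
    apply/eqP; rewrite -subset0; apply/subsetP => B.
    case/setIP=> /setIdP[/imsetP[C FC ->] _] /setIdP[].
    rewrite mem_ksets subsetD -setI_eq0 => /andP[/andP[_ e0] _] _.
    by move: (meet C G FC FG); rewrite setIAC e0.
  rewrite cards0 addn0; apply: subset_leq_card; rewrite subUset; apply/andP; split.
    by apply/subsetP => B AB; rewrite inE (subsetP AY) // sub1set Ax.
  apply/subsetP => B; rewrite !inE subsetD => /andP[/andP[/andP[-> _] ->]] ->.
  by [].
have [ntA|/nontrivialPn[x]] := boolP (nontrivial A); last exact: star.
have [m1|m1] := eqVneq m 1.
  case: (set_0Vmem A) => [e|[B0 AB0]]; first by rewrite e cards0.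
  have : B0 \in ksets Y m by apply: (subsetP AY).
  rewrite mem_ksets {1}m1 => /andP[_ /cards1P[x eB]].
  apply: (star x) => B AB; have /set0Pn[y] := intersectingP A AI B B0 AB AB0.
  by rewrite eB !inE => /andP[yB /eqP <-].
have := IH m mk Y A; rewrite cY => /(_ _ AY AI ntA); rewrite /hilton_milner_bound.
have : 2 * m <= 2 * k by lia.
move=> -> /(_ isT).
(* By Pascal's rule ['C(k, m - 1)] is at least ['C(k - 1, m - 1) + 1] once [m >= 2], and
   [k <= 2 * k - m - 1] because [m < k]. *)
have : 'C(k - 1, m - 1) + 1 <= 'C(2 * k - m - 1, m - 1).
  apply: (@leq_trans 'C(k, m - 1)); last by apply: leq_bin2l; lia.
  case: (k) (m) mk m1 m0 => [|k'] [|[|m']] //= mk _ _; rewrite !subSS !subn0 binS leq_add2l.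
  by rewrite bin_gt0; lia.
have : 'C(2 * k - m - 1, m - 1) <= 'C(2 * k - 1, m - 1) by apply: leq_bin2l; lia.
move=> h1 h2 h3; apply: leq_trans (leq_add h3 (leqnn _)) _; lia.
Qed.

(** A set and its complement in [Y] are not both traces, so the traces of size [k] number at most
    half of ['C(2 * k, k)]. *)
Lemma trace_bound_top Y F k : 0 < k -> #|Y| = 2 * k ->
  {in F &, forall A B, A :&: B :&: Y != set0} ->
  #|[set B in traces Y F | #|B| == k]| <= 'C(2 * k - 1, k - 1).
Proof.
move=> k0 cY meet; set A := [set B in _ | _].
have AY : A \subset ksets Y k.
  by apply/subsetP => _ /setIdP[/imsetP[B _ ->] cB]; rewrite mem_ksets subsetIr.
pose A' := [set Y :\: B | B in A].
have A'Y : A' \subset ksets Y k.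
  apply/subsetP => _ /imsetP[B AB ->].
  move: (subsetP AY B AB); rewrite !mem_ksets subsetDl.
  move=> /andP[BY /eqP cB]; rewrite cardsD (setIidPr BY) cB cY; apply/eqP; lia.
have cA' : #|A'| = #|A|.
  apply: card_in_imset => B C AB AC /(congr1 (setD Y)).
  move: (subsetP AY B AB) (subsetP AY C AC); rewrite !mem_ksets => /andP[BY _] /andP[CY _].
  by rewrite !setDDr !setDv !set0U (setIidPr BY) (setIidPr CY).
have dis : A :&: A' = set0.
  apply/eqP; rewrite -subset0; apply/subsetP => B /setIP[AB /imsetP[C AC eB]].
  move: AB AC; rewrite !inE => /andP[/imsetP[B1 F1 e1] _] /andP[/imsetP[C1 F2 e2] _].
  have /set0Pn[x] := meet _ _ F1 F2; rewrite !inE -andbA => /and3P[x1 x2 xY].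
  have : x \in B by rewrite e1 inE x1.
  by rewrite eB inE e2 inE x2 xY.
have : #|A :|: A'| <= #|ksets Y k| by rewrite subset_leq_card // subUset AY A'Y.
rewrite cardsU dis cards0 subn0 cA' card_ksets cY.
case: (k) k0 => // k' _.
have := bin_sub (_ : k' <= 2 * k'.+1 - 1) => /(_ ltac:(lia)).
have -> : 2 * k'.+1 - 1 - k' = k'.+1 by lia.
have -> : 2 * k'.+1 = (2 * k'.+1 - 1).+1 by lia.
have -> : k'.+1 - 1 = k' by lia.
by rewrite binS subSS subn0 => ->; rewrite !addnn leq_double.
Qed.

(** Vandermonde splits both binomials of the bound along [Y], and the trace bounds compare them term
    by term. Only the traces of full size [k] come without a saving, which costs the summand 1. *)
Lemma hilton_milner_of_meet Y F E k : 0 < k -> (forall l, l < k -> hilton_milner_at l) ->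
  Y \subset E -> F \subset ksets E k -> nontrivial F -> #|Y| = 2 * k ->
  {in F &, forall A B, A :&: B :&: Y != set0} -> #|F| <= hilton_milner_bound #|E| k.
Proof.
move=> k0 IH YE FE nt cY meet.
have cYE := subset_leq_card YE; rewrite cY in cYE.
have := trace_count E Y F k YE FE.
case: k => // k' in k0 IH FE cY cYE *.
have a0 : [set B in traces Y F | #|B| == 0] = set0.
  apply/setP => B; rewrite !inE; apply/negP => /andP[/imsetP[A FA ->]].
  by rewrite cards_eq0; have := meet A A FA FA; rewrite setIid => /negPf->.
rewrite big_ord_recl /= a0 cards0 mul0n add0n.
under eq_bigr do rewrite /bump leq0n add1n subSS.
set s := \sum_(_ < _) _ => Fs.
have := binomial.Vandermonde k' (#|E| - #|Y|) k'.
have := binomial.Vandermonde (2 * k'.+1 - 1) (#|E| - #|Y|) k'.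
set v1 := \sum_(_ < _) _; set v2 := \sum_(_ < _) _ => e1 e2.
have le : s + v2 <= v1 + 1.
  rewrite /s /v1 /v2 -big_split !big_ord_recr /= -addnA.
  apply: leq_add.
    apply: leq_sum => i _; rewrite -mulnDl leq_mul2r; apply/orP; right.
    have := trace_bound Y F E k'.+1 i.+1 IH FE nt cY meet.
    by rewrite !ltnS leq0n ltn_ord !subSS !subn0; apply.
  have := trace_bound_top Y F k'.+1 k0 cY meet.
  by rewrite subnn !bin0 binn !muln1 subSS subn0 leq_add2r.
rewrite /hilton_milner_bound subSS subn0.
have -> : #|E| - k'.+1 - 1 = k' + (#|E| - #|Y|) by lia.
have -> : #|E| - 1 = 2 * k'.+1 - 1 + (#|E| - #|Y|) by lia.
rewrite -e1 -e2; lia.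
Qed.

Lemma mem_exchange i j A x : x != i -> x != j -> (x \in exchange i j A) = (x \in A).
Proof. by move=> xi xj; rewrite !inE (negPf xi) xj. Qed.

Lemma mem_shift1 i j F A x : x != i -> x != j -> (x \in shift1 i j F A) = (x \in A).
Proof. by move=> xi xj; rewrite /shift1; case: ifP => // _; apply: mem_exchange. Qed.

Lemma exists_kset E D k : D \subset E -> #|D| <= k <= #|E| ->
  exists Y, [/\ D \subset Y, Y \subset E & #|Y| = k].
Proof.
move=> DE /andP[Dk kE].
have : 0 < #|[set A in ksets E k | D \subset A]|.
  by rewrite card_ksets_sup // bin_gt0 leq_sub2r.
by case/card_gt0P => Y; rewrite inE mem_ksets => /andP[/andP[YE /eqP cY] DY]; exists Y.
Qed.

(* F is first enlarged by all k-sets containing a and b: they survive every shift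
   fixing a and b, which keeps the family nontrivial. *)
Lemma hilton_milner_two_points E F k a b : 1 < k -> (forall l, l < k -> hilton_milner_at l) ->
  2 * k <= #|E| -> F \subset ksets E k -> intersecting F -> nontrivial F ->
  a != b -> {in F, forall A, (a \in A) || (b \in A)} -> #|F| <= hilton_milner_bound #|E| k.
Proof.
move=> k1 IH kE /subsetP FE /intersectingP FI /nontrivialP nt ab Fab.
have [Aa FAa aAa] := nt a; have [Ab FAb bAb] := nt b.
have AE A : A \in F -> A \subset E by move=> /FE; rewrite mem_ksets => /andP[].
have bE : b \in E.
  by apply: (subsetP (AE _ FAa)); have := Fab _ FAa; rewrite (negPf aAa).
have aE : a \in E.
  by apply: (subsetP (AE _ FAb)); have := Fab _ FAb; rewrite (negPf bAb) orbF.
have abE : [set a; b] \subset E by rewrite subUset !sub1set aE.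
pose D := [set A in ksets E k | [set a; b] \subset A].
have DP A : A \in D -> [/\ a \in A, b \in A & A \in ksets E k].
  by rewrite inE subUset !sub1set => /and3P[? ? ?].
pose F1 := F :|: D.
have cab : #|[set a; b]| = 2 by rewrite cards2 ab.
have E2k : #|[set a; b]| <= 2 * k <= #|E| by rewrite cab kE andbT leq_pmulr // ltnW.
have [Y [abY YE cY]] := exists_kset E _ (2 * k) abE E2k.
have [aY bY] : a \in Y /\ b \in Y by move: abY; rewrite subUset !sub1set => /andP.
pose P G := [&& G \subset ksets E k, intersecting G, D \subset G,
  [forall A in G, (a \in A) || (b \in A)], [exists A in G, a \notin A],
  [exists A in G, b \notin A] & #|G| == #|F1|].
have PF1 : P F1.
  apply/and5P; split.
  - by apply/subsetP => A /setUP[/FE|/DP[]].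
  - apply/intersectingP => A B /setUP[FA|/DP[aA bA _]] /setUP[FB|/DP[aB bB _]].
    + exact: FI.
    + by apply/set0Pn; case/orP: (Fab _ FA) => ?; [exists a|exists b]; apply/setIP.
    + by apply/set0Pn; case/orP: (Fab _ FB) => ?; [exists a|exists b]; apply/setIP.
    + by apply/set0Pn; exists a; apply/setIP.
  - exact: subsetUr.
  - by apply/forall_inP => A /setUP[/Fab|/DP[->]].
  - apply/and3P; split=> //; apply/exists_inP.
      by exists Aa; rewrite ?inE ?FAa.
    by exists Ab; rewrite ?inE ?FAb.
have [G /and5P[GE GI DG /forall_inP Gab PG] Gmax] := arg_maxnP (weight Y) PF1.
have /and3P[/exists_inP[Ba GBa aBa] /exists_inP[Bb GBb bBb] /eqP cG] := PG.
apply: leq_trans (subset_leq_card (subsetUl F D)) _; rewrite -/F1 -cG.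
(* For [x] other than [a] and [b], a [k]-set through both that avoids [x] belongs to [D]. *)
have ntG : nontrivial G.
  apply/nontrivialP => x.
  have [->|xa] := eqVneq x a; first by exists Ba.
  have [->|xb] := eqVneq x b; first by exists Bb.
  have abEx : [set a; b] \subset E :\ x.
    by rewrite subUset !sub1set !inE eq_sym xa eq_sym xb aE bE.
  have kEx : #|[set a; b]| <= k <= #|E :\ x|.
    rewrite cab k1 /= -ltnS; apply: (@leq_trans #|E|); last first.
      by rewrite (cardsD1 x E); case: (x \in E).
    by apply: leq_trans kE; rewrite mul2n -addnn -addn1 leq_add2l ltnW.
  have [A [abA AEx cA]] := exists_kset _ _ k abEx kEx.
  exists A; last by move: AEx; rewrite subsetD1 => /andP[].
  apply: (subsetP DG); rewrite inE abA mem_ksets cA eqxx !andbT.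
  exact: subset_trans AEx (subsetDl _ _).
pose I := Y :\: [set a; b].
have st : stable I Y G.
  move=> i j A; rewrite !inE negb_or -andbA => /and3P[ia ib iY] jY GA jA iA.
  apply: contraT => nA; have := weight_shift i j Y G A iY jY GA jA iA nA.
  rewrite ltnNge; have -> // : weight Y (shift i j G) <= weight Y G.
  have [ja jb] : j != a /\ j != b by split; apply: contraNneq jY => ->.
  apply: Gmax; apply/and5P; split.
  - by apply: shift_ksets => //; apply: (subsetP YE).
  - exact: shift_intersecting.
  - apply/subsetP => B DB; apply/imsetP; exists B; first exact: (subsetP DG).
    rewrite /shift1; case: ifP => // /and3P[jB iB /negP[]].
    apply: (subsetP DG); have [aB bB] := DP _ DB.
    rewrite mem_ksets => /andP[BE cB].
    rewrite inE mem_ksets card_exchange // cB andbT subUset !sub1set.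
    rewrite !mem_exchange 1?eq_sym // aB bB andbT.
    by rewrite subUset sub1set (subsetP YE) //= (subset_trans (subsetDl _ _)).
  - apply/forall_inP => _ /imsetP[B GB ->].
    by rewrite !mem_shift1 1?eq_sym // Gab.
  - apply/and3P; split; last by rewrite card_shift cG.
      apply/exists_inP; exists (shift1 i j G Ba); first exact: imset_f.
      by rewrite mem_shift1 1?eq_sym.
    apply/exists_inP; exists (shift1 i j G Bb); first exact: imset_f.
    by rewrite mem_shift1 1?eq_sym.
apply: (hilton_milner_of_meet Y) => //; first exact: ltnW.
apply: (stable_meet I Y G (subsetDl _ _) GI st) => A B j GA GB jY jA jB.
apply/negP => IAB.
have cI : #|I| = 2 * k - 2 by rewrite cardsD (setIidPr abY) cY cab.
have Gk C : C \in G -> #|C| = k.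
  by move=> /(subsetP GE); rewrite mem_ksets => /andP[_ /eqP].
(* Besides [j], each of [A] and [B] contains [a] or [b], so together they cover at most [2 * k - 4]
   points of [I], which has [2 * k - 2]. *)
pose Q := [set a; b; j].
have ja : j != a by apply: contraNneq jY => ->.
have jb : j != b by apply: contraNneq jY => ->.
have small C : C \in G -> j \in C -> #|C :\: Q| <= k - 2.
  move=> GC jC; rewrite cardsD Gk //.
  apply: leq_sub2l; have [c [cQ cC cj]] : exists c, [/\ c \in Q, c \in C & j != c].
    by case/orP: (Gab _ GC) => ?; [exists a|exists b]; rewrite !inE eqxx ?orbT.
  have <- : #|[set j; c]| = 2 by rewrite cards2 cj.
  apply: subset_leq_card; rewrite subUset !sub1set !inE eqxx orbT jC cC.
  by move: cQ; rewrite !inE => ->.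
have : I \subset (A :\: Q) :|: (B :\: Q).
  apply/subsetP => x xI; have := subsetP IAB x xI; move: xI.
  rewrite !inE => /andP[/negPf-> xY].
  suff -> : x == j = false by [].
  by apply: contraNF jY => /eqP <-.
move/subset_leq_card; rewrite cI leqNgt => /negP[].
have := small A GA jA; have := small B GB jB; have := leq_card_setU (A :\: Q) (B :\: Q).
move=> h1 h2 h3; apply: leq_ltn_trans h1 (leq_ltn_trans (leq_add h3 h2) _).
by clear -k1; lia.
Qed.

(* A shift of j into i can destroy nontriviality only by creating a star centred at
   i, and then every member of the family meets {i, j}. *)
Lemma hilton_milner k : 0 < k -> hilton_milner_at k.
Proof.
have [m] := ubnP k; elim: m k => // m IHm k km k0.
have IH l : l < k -> hilton_milner_at l.
  case: (posnP l) => [-> _ E F _ /subsetP FE /intersectingP FI nt | l0 lk].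
    suff -> : F = set0 by rewrite cards0.
    apply/eqP; rewrite -subset0; apply/subsetP => A FA.
    have := FE A FA; rewrite mem_ksets cards_eq0 => /andP[_ /eqP e0].
    by have := FI A A FA FA; rewrite e0 setI0 eqxx.
  by apply: IHm => //; rewrite ltnS in km; apply: leq_trans km.
move=> E F kE FE FI nt.
have [k1|k1] := leqP k 1.
  have {k1}k1 : k = 1 by apply/eqP; rewrite eqn_leq k1.
  have /card_gt0P[x _] : 0 < #|E| by apply: leq_trans kE; rewrite k1.
  have [A FA _] := nontrivialP F nt x.
  have := subsetP FE A FA; rewrite mem_ksets {1}k1 => /andP[_ /cards1P[y eA]].
  have [B FB yB] := nontrivialP F nt y.
  have /set0Pn[z] := intersectingP F FI A B FA FB.
  by rewrite eA !inE => /andP[/eqP-> yB']; rewrite yB' in yB.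
have E2k : #|@set0 T| <= 2 * k <= #|E| by rewrite cards0.
have [Y [_ YE cY]] := exists_kset E set0 (2 * k) (sub0set _) E2k.
pose P G := [&& G \subset ksets E k, intersecting G, nontrivial G & #|G| == #|F|].
have PF : P F by rewrite /P FE FI nt eqxx.
have [G /and4P[GE GI Gnt /eqP cG] Gmax] := arg_maxnP (weight Y) PF.
rewrite -cG.
have [[i [j [ij Gij]]]|nij] :
  (exists i j, i != j /\ {in G, forall A, (i \in A) || (j \in A)}) \/
  (forall i j, i != j -> exists2 A, A \in G & ~~ ((i \in A) || (j \in A))).
- case: (boolP [exists i, exists j, (i != j) && [forall A in G, (i \in A) || (j \in A)]]).
    case/existsP=> i /existsP[j /andP[ij /forall_inP Gij]]; left.
    by exists i, j.
  move=> /existsPn H; right=> i j ij; have /existsPn/(_ j) := H i.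
  rewrite ij /= => /forallPn[A]; rewrite negb_imply => /andP[GA nA].
  by exists A.
- exact: (hilton_milner_two_points E G k i j).
apply: (hilton_milner_of_meet Y) => //.
have st : stable Y Y G.
  move=> i j A iY jY GA jA iA.
  apply: contraT => nA; have := weight_shift i j Y G A iY jY GA jA iA nA.
  rewrite ltnNge; have -> // : weight Y (shift i j G) <= weight Y G.
  apply: Gmax; apply/and4P; split.
  - by apply: shift_ksets => //; apply: (subsetP YE).
  - exact: shift_intersecting.
  - apply: contraT => /nontrivialPn[x Hx].
    have shx B : B \in G -> x \in shift1 i j G B by move=> GB; apply/Hx/imset_f.
    have [xi|xi] := eqVneq x i.
      have ij : i != j by apply: contraNneq jY => <-.
      have [B GB] := nij i j ij; have := shx B GB; rewrite xi negb_or /shift1.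
      by case: ifP => [/and3P[-> _ _]|_ ->] //; rewrite andbF.
    have [B GB xB] := nontrivialP G Gnt x.
    move: (shx B GB); rewrite /shift1; case: ifP => _; last by rewrite (negPf xB).
    by rewrite !inE (negPf xi) (negPf xB) andbF.
  - by rewrite card_shift cG.
apply: (stable_meet Y Y G (subxx _) GI st) => A B j GA GB jY jA jB.
apply/negP => YAB; have : j |: Y \subset A :|: B.
  by rewrite subUset sub1set inE jA YAB.
move/subset_leq_card; rewrite cardsU1 jY cY cardsU => le.
have Gk C : C \in G -> #|C| = k.
  by move=> /(subsetP GE); rewrite mem_ksets => /andP[_ /eqP].
by have := leq_trans le (leq_subr _ _); rewrite !Gk // mul2n -addnn ltnn.
Qed.

End SetFamilies.

(** * Exchanges and permutations of points *)

(** On a walk from [A] to [B] that exchanges one point of [A :\: B] for one of [B :\: A] at a time,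
    some step must leave [Q]. *)
Lemma swap_boundary (T : finType) (E : {set T}) k (Q : {set {set T}}) (A B : {set T}) :
  A \in ksets E k -> B \in ksets E k -> A \in Q -> B \notin Q ->
  exists C a b, [/\ C \in ksets E k, C \in Q, a \in C, b \in E :\: C &
    exchange b a C \notin Q].
Proof.
have [m] := ubnP #|A :\: B|; elim: m A => // m IHm A mAB AE BE QA QB.
have [/eqP e0|[a]] := set_0Vmem (A :\: B).
  move: e0; rewrite setD_eq0 => AB; case/negP: QB; suff <- : A = B by [].
  apply/eqP; rewrite eqEcard AB; move: AE BE; rewrite !mem_ksets.
  by move=> /andP[_ /eqP ->] /andP[_ /eqP ->] /=.
rewrite inE => /andP[aB aA].
have /subsetPn[b bB bA] : ~~ (B \subset A).
  apply: contra aB => BA; suff -> : B = A by [].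
  apply/eqP; rewrite eqEcard BA; move: AE BE; rewrite !mem_ksets.
  by move=> /andP[_ /eqP ->] /andP[_ /eqP ->] /=.
have bE : b \in E by move: BE; rewrite mem_ksets => /andP[/subsetP/(_ b bB)].
have [QC|QC] := boolP (exchange b a A \in Q); last first.
  by exists A, a, b; split; rewrite // inE bA bE.
apply: IHm BE QC QB.
  move: mAB; rewrite (cardsD1 a (A :\: B)) !inE aB aA ltnS.
  apply: leq_ltn_trans; apply/subset_leq_card/subsetP => x; rewrite !inE.
  by case/andP=> xB /orP[/eqP xb|/andP[-> ->]]; [rewrite xb bB in xB | rewrite xB].
move: AE; rewrite !mem_ksets card_exchange // => /andP[AE ->].
by rewrite subUset sub1set bE (subset_trans (subsetDl _ _)).
Qed.

Lemma imset_tperm (T : finType) (a b : T) (A : {set T}) :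
  a \in A -> b \notin A -> tperm a b @: A = exchange b a A.
Proof.
move=> aA bA; apply/setP => x; rewrite -[x](tpermK a b) mem_imset; last exact: perm_inj.
rewrite !inE tpermK; case: tpermP => [->|->|/eqP/negPf xa /eqP/negPf xb].
- by rewrite eqxx (negPf bA) /= orbF; apply/esym/negP => /eqP ab; rewrite -ab aA in bA.
- by rewrite eqxx aA.
- by rewrite xa xb.
Qed.

Lemma imset_tperm_id (T : finType) (a b : T) (A : {set T}) :
  (a \in A) = (b \in A) -> tperm a b @: A = A.
Proof.
move=> ab; apply/setP => x; rewrite -[x](tpermK a b) mem_imset; last exact: perm_inj.
by rewrite tpermK; case: tpermP => // ->.
Qed.

Lemma exists_swap_perm (T : finType) (A B : {set T}) : [disjoint A & B] -> #|A| = #|B| ->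
  exists g : {perm T}, g @: A = B /\ g @: B = A.
Proof.
move=> dAB cAB.
(* Matches the enumerations of [A] and [B] position by position and fixes all other points; the
   default of [nth] is never reached. *)
pose f x := if x \in A then nth x (enum B) (index x (enum A)) else
            if x \in B then nth x (enum A) (index x (enum B)) else x.
have half (C D : {set T}) x : #|C| = #|D| -> x \in C ->
    nth x (enum D) (index x (enum C)) \in D /\
    index (nth x (enum D) (index x (enum C))) (enum D) = index x (enum C).
  move=> cCD xC.
  have lt : index x (enum C) < size (enum D) by rewrite -cardE -cCD cardE index_mem mem_enum.
  by rewrite -[_ \in D]mem_enum mem_nth // index_uniq // enum_uniq.
have fA x : x \in A -> f x \in B.
  by move=> xA; rewrite /f xA; have [] := half A B x cAB xA.
have nAB x : x \in B -> x \in A = false.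
  by move=> xB; apply/negP => xA; rewrite (disjointFr dAB xA) in xB.
have fB x : x \in B -> f x \in A.
  by move=> xB; rewrite /f (nAB x xB) xB; have [] := half B A x (esym cAB) xB.
have fK : involutive f.
  move=> x; rewrite {2}/f; case: ifP => xA.
    have [yB iy] := half A B x cAB xA; rewrite /f (nAB _ yB) yB iy.
    by rewrite (set_nth_default x) ?index_mem ?nth_index ?mem_enum.
  case: ifP => xB.
    have [yA iy] := half B A x (esym cAB) xB; rewrite /f yA iy.
    by rewrite (set_nth_default x) ?index_mem ?nth_index ?mem_enum.
  by rewrite /f xA xB.
exists (perm (inv_inj fK)); split; apply/setP => x; apply/imsetP/idP.
- by case=> y yA ->; rewrite permE fA.
- by move=> xB; exists (f x); rewrite ?permE ?fK // fB.
- by case=> y yA ->; rewrite permE fB.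
- by move=> xA; exists (f x); rewrite ?permE ?fK // fA.
Qed.

(** * Super-connectivity of Kneser graphs *)

Section Kneser.

Variables n k : nat.
Implicit Types (A B C u v w : {set 'I_n}) (F X : {set {set 'I_n}}) (g : {perm 'I_n}).

Notation K := (kverts n k).
Notation nbrs A := (ksets (~: A) k).

Definition closed_nbhd F :=
  [set A in K | (A \in F) || [exists B in F, kneser_adj n A B]].

Definition boundary F := #|closed_nbhd F :\: F|.

(** Single vertices are left out because their boundary is exactly ['C(n - k, k)], the value to be
    exceeded. *)
Definition splitting F := [&& F \subset K, 1 < #|F| & 1 < #|K :\: closed_nbhd F|].

Lemma in_kverts A : (A \in K) = (#|A| == k).
Proof. by rewrite inE. Qed.

Lemma mem_nbrs A B : (B \in nbrs A) = (B \in K) && kneser_adj n A B.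
Proof. by rewrite mem_ksets -disjoints_subset disjoint_sym in_kverts andbC. Qed.

Lemma card_nbrs A : A \in K -> #|nbrs A| = 'C(n - k, k).
Proof.
by rewrite in_kverts => /eqP cA; rewrite card_ksets cardsCs setCK cA card_ord.
Qed.

Lemma kneser_sym A B : kneser_adj n A B = kneser_adj n B A.
Proof. exact: disjoint_sym. Qed.

Lemma closed_nbhdP F A :
  reflect (A \in K /\ (A \in F \/ exists2 B, B \in F & kneser_adj n A B))
          (A \in closed_nbhd F).
Proof.
rewrite [X in reflect _ X]in_set; apply: (iffP andP) => -[AK].
  by case/orP=> [|/exists_inP]; split; auto.
by case=> H; split=> //; apply/orP; [left|right; apply/exists_inP].
Qed.

Lemma nbhd_sub F : closed_nbhd F \subset K.
Proof. by apply/subsetP => A /closed_nbhdP[]. Qed.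

Lemma sub_nbhd F : F \subset K -> F \subset closed_nbhd F.
Proof. by move=> /subsetP FK; apply/subsetP => A FA; apply/closed_nbhdP; auto. Qed.

Lemma nbhdS F X : F \subset X -> closed_nbhd F \subset closed_nbhd X.
Proof.
move=> /subsetP FX; apply/subsetP => A /closed_nbhdP[AK H]; apply/closed_nbhdP.
by split=> //; case: H => [/FX|[B /FX]]; [left|right; exists B].
Qed.

Lemma nbhdU F X : closed_nbhd (F :|: X) = closed_nbhd F :|: closed_nbhd X.
Proof.
apply/eqP; rewrite eqEsubset subUset !nbhdS ?subsetUl ?subsetUr // !andbT.
apply/subsetP => A /closed_nbhdP[AK H]; apply/setUP.
case: H => [/setUP[]|[B /setUP[]]]; [left|right|left|right];
  by apply/closed_nbhdP; split=> //; (left + (right; exists B)).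
Qed.

Lemma nbrs_nbhd F A : A \in F -> nbrs A \subset closed_nbhd F.
Proof.
move=> FA; apply/subsetP => B; rewrite mem_nbrs => /andP[BK AB].
by apply/closed_nbhdP; split=> //; right; exists A; rewrite // kneser_sym.
Qed.

Lemma card_nbhd F : F \subset K -> #|closed_nbhd F| = #|F| + boundary F.
Proof. by move=> FK; rewrite -(cardsID F) (setIidPr (sub_nbhd F FK)). Qed.

Lemma boundary1 v : 0 < k -> v \in K -> boundary [set v] = 'C(n - k, k).
Proof.
move=> k0 vK; rewrite -(card_nbrs v vK) /boundary; apply: eq_card => A.
rewrite mem_nbrs !inE -in_kverts; apply/idP/idP.
  case/and3P=> Av AK; rewrite AK (negPf Av) => /exists_inP[B].
  by rewrite inE kneser_sym => /eqP ->.
case/andP=> -> vA; apply/andP; split.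
  apply: contraTneq vA => ->; rewrite /kneser_adj -setI_eq0 setIid -cards_eq0.
  by move: vK; rewrite in_kverts => /eqP ->; rewrite -lt0n.
by apply/orP; right; apply/exists_inP; exists v; rewrite ?inE // kneser_sym.
Qed.

Definition image_fam g F := [set g @: A | A : {set 'I_n} in F].

Lemma imset_permK g F : image_fam g^-1%g (image_fam g F) = F.
Proof.
have gK A : g^-1%g @: (g @: A) = A.
  by rewrite -imset_comp -[RHS]imset_id; apply: eq_imset => x /=; rewrite permK.
by rewrite /image_fam -imset_comp -[RHS]imset_id; apply: eq_imset => A /=; exact: gK.
Qed.

Lemma nbhd_imset_sub g F :
  image_fam g (closed_nbhd F) \subset closed_nbhd (image_fam g F).
Proof.
apply/subsetP => _ /imsetP[A /closed_nbhdP[AK H] ->]; apply/closed_nbhdP; split.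
  by move: AK; rewrite !in_kverts card_imset //; apply: perm_inj.
case: H => [FA|[B FB AB]]; [left; exact: imset_f|right].
exists (g @: B); first exact: imset_f.
by rewrite /kneser_adj imset_disjoint //; apply: perm_inj.
Qed.

Lemma card_imset_perm g F : #|image_fam g F| = #|F|.
Proof. by rewrite card_imset //; apply/imset_inj/perm_inj. Qed.

Lemma card_nbhd_imset g F : #|closed_nbhd (image_fam g F)| = #|closed_nbhd F|.
Proof.
apply/eqP; rewrite eqn_leq; apply/andP; split.
  rewrite -[leqLHS](card_imset_perm g^-1%g).
  apply: leq_trans (subset_leq_card (nbhd_imset_sub _ _)) _.
  by rewrite imset_permK.
by rewrite -[leqLHS](card_imset_perm g) subset_leq_card // nbhd_imset_sub.
Qed.

Lemma imset_perm_sub g F : F \subset K -> (image_fam g F) \subset K.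
Proof.
move=> /subsetP FK; apply/subsetP => _ /imsetP[A /FK AK ->]; move: AK.
by rewrite !in_kverts card_imset //; apply: perm_inj.
Qed.

(** A [k]-set that avoids [B] and contains a point of [A :\: B] is adjacent to [B] but not to
    [A]. *)
Lemma two_nbrs A B : 2 * k <= n -> A \in K -> B \in K -> A != B ->
  'C(n - k, k) < #|nbrs A :|: nbrs B|.
Proof.
move=> nk AK BK AB; rewrite -(card_nbrs A AK); apply: proper_card.
rewrite properE subsetUl subUset subxx /=.
move: AK BK; rewrite !in_kverts => /eqP cA /eqP cB.
have /subsetPn[x xA xB] : ~~ (A \subset B) by rewrite eqEcard cA cB leqnn andbT in AB.
have c1 : #|[set x]| <= k <= #|~: B|.
  rewrite cards1 cardsCs setCK card_ord cB -cA card_gt0; apply/andP; split.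
    by apply/set0Pn; exists x.
  by rewrite cA; lia.
have xB' : [set x] \subset ~: B by rewrite sub1set inE.
have [w [xw wB cw]] := exists_kset _ _ k xB' c1.
apply/subsetPn; exists w; rewrite mem_ksets cw eqxx andbT //.
by apply/subsetPn; exists x; [rewrite -sub1set | rewrite inE xA].
Qed.

(** No vertex outside [closed_nbhd F] has a neighbour in [F], so the boundary of the far side is
    contained in that of [F]. This lets a smallest [F] be compared in size with its far side. *)
Lemma splitting_compl F : splitting F -> splitting (K :\: closed_nbhd F) /\
  boundary (K :\: closed_nbhd F) <= boundary F.
Proof.
case/and3P=> FK F2 cF2; set X := K :\: closed_nbhd F.
have XF : closed_nbhd X \subset K :\: F.
  rewrite subsetD nbhd_sub -setI_eq0 -subset0; apply/subsetP => A.
  case/setIP=> /closed_nbhdP[AK H] FA; suff : A \in set0 by [].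
  case: H => [/setDP[_ /negP[]]|[B /setDP[BK nB] BA]].
    exact: (subsetP (sub_nbhd F FK)).
  by case/negP: nB; apply/closed_nbhdP; split=> //; right; exists A; rewrite // kneser_sym.
split.
  apply/and3P; split=> //; first exact: subsetDl.
  apply: leq_trans F2 _; apply/subset_leq_card/subsetP => A FA.
  rewrite inE (subsetP FK) // andbT; apply/negP => /(subsetP XF).
  by rewrite inE FA.
apply/subset_leq_card/subsetP => A /setDP[/(subsetP XF) /setDP[AK AF]].
by rewrite !in_setD AK AF andbT negbK.
Qed.

(* Submodularity of the boundary, applied to F and X: both the intersection and the
   union have boundary at least that of F, so all inequalities are equalities. *)
Lemma atom_meet F X : 0 < k -> splitting F ->
  (forall X, splitting X -> boundary F <= boundary X) ->
  (forall X, splitting X -> boundary X <= boundary F -> #|F| <= #|X|) ->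
  boundary F <= 'C(n - k, k) ->
  X \subset K -> #|X| = #|F| -> #|closed_nbhd X| = #|closed_nbhd F| ->
  F :&: X != set0 ->
  F = X \/ exists2 v, F :&: X = [set v] & closed_nbhd F :&: closed_nbhd X = closed_nbhd [set v].
Proof.
move=> k0 sF minb minF bd XK cX cbX.
have /and3P[FK F2 cF2] := sF.
have [sF' bF'] := splitting_compl F sF.
have := minF _ sF' bF'; rewrite cardsD (setIidPr (nbhd_sub F)) => lF.
rewrite -card_gt0; set I := F :&: X => I0.
have IF : I \subset F := subsetIl _ _.
have IK : I \subset K := subset_trans IF FK.
have bI : boundary F <= boundary I.
  have [I1|I2] := leqP #|I| 1.
    have /cards1P[v ev] : #|I| == 1 by rewrite eqn_leq I1.
    have vK : v \in K by apply: (subsetP IK); rewrite ev inE.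
    by rewrite ev boundary1.
  apply: minb; apply/and3P; split=> //; apply: leq_trans cF2 _.
  exact/subset_leq_card/setDS/nbhdS.
have UK : F :|: X \subset K by rewrite subUset FK XK.
have cU : #|F :|: X| + #|I| = 2 * #|F| by rewrite cardsUI cX mul2n addnn.
have eU : #|closed_nbhd (F :|: X)| + #|closed_nbhd F :&: closed_nbhd X| = 2 * #|closed_nbhd F|.
  by rewrite nbhdU cardsUI cbX mul2n addnn.
have subI : closed_nbhd I \subset closed_nbhd F :&: closed_nbhd X.
  by rewrite subsetI !nbhdS ?subsetIl ?subsetIr.
have lI := subset_leq_card subI.
have nI := card_nbhd I IK; have nF := card_nbhd F FK.
have nU := card_nbhd _ UK.
have KU : #|K :\: closed_nbhd (F :|: X)| = #|K| - #|closed_nbhd (F :|: X)|.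
  by rewrite cardsD (setIidPr (nbhd_sub _)).
have FleK := subset_leq_card (nbhd_sub F).
(* [lF] says that the far side of [F] is at least as large as [F]; with [bI] this leaves at least
   [#|I|] vertices outside [closed_nbhd (F :|: X)]. *)
have U1 : 0 < #|K :\: closed_nbhd (F :|: X)|.
  by rewrite KU; move: lF cU eU lI nI nF I0 bI FleK F2; clear; lia.
have bU : boundary F <= boundary (F :|: X).
  have [U2|U2] := leqP #|K :\: closed_nbhd (F :|: X)| 1; last first.
    apply: minb; apply/and3P; split=> //.
    by apply: leq_trans F2 _; apply/subset_leq_card/subsetUl.
  (* All neighbours of the last vertex [w] lie in the boundary of the union. *)
  have /cards1P[w ew] : #|K :\: closed_nbhd (F :|: X)| == 1 by rewrite eqn_leq U2.
  have : w \in K :\: closed_nbhd (F :|: X) by rewrite ew inE.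
  case/setDP=> wK wU; apply: leq_trans bd _; rewrite -(card_nbrs w wK).
  apply/subset_leq_card/subsetP => A; rewrite mem_nbrs => /andP[AK wA].
  have AU : A \notin F :|: X.
    apply: contra wU => AU; apply/closed_nbhdP; split=> //; right.
    by exists A; rewrite // kneser_sym.
  rewrite in_setD AU /=; apply: contraT => nA.
  have : A \in [set w] by rewrite -ew in_setD nA.
  rewrite inE => /eqP eA; move: wA; rewrite eA /kneser_adj -setI_eq0 setIid -cards_eq0.
  by move: wK; rewrite in_kverts => /eqP->; rewrite eqn0Ngt k0.
have ar (u i f nu nx nf ni bf bu bi : nat) : u + i = 2 * f -> nu + nx = 2 * nf ->
    ni = i + bi -> nf = f + bf -> nu = u + bu -> bf <= bi -> bf <= bu ->
    nx <= ni /\ (ni <= nx -> bi <= bf) by clear; lia.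
have [le1 le2] := ar _ _ _ _ _ _ _ _ _ _ cU eU nI nF nU bI bU.
have eqI : closed_nbhd I = closed_nbhd F :&: closed_nbhd X.
  by apply/eqP; rewrite eqEcard subI; exact: le1.
have eI : boundary I <= boundary F := le2 lI.
have [I1|I2] := leqP #|I| 1.
  right; have /cards1P[v ev] : #|I| == 1 by rewrite eqn_leq I1.
  by exists v; rewrite // -eqI ev.
(* With two vertices, [I] is itself splitting and of minimal boundary, so minimality in size applies
   to it. *)
left; have : #|F| <= #|I|.
  apply: minF => //; apply/and3P; split=> //; apply: leq_trans cF2 _.
  exact/subset_leq_card/setDS/nbhdS.
move=> FI; have eFI : I = F by apply/eqP; rewrite eqEcard IF FI.
by apply/eqP; rewrite eqEcard cX leqnn andbT -eFI subsetIr.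
Qed.

(** Two common vertices rule out an intersection in a single vertex, leaving only equality. *)
Lemma perm_atom F g v u : 0 < k -> splitting F ->
  (forall X, splitting X -> boundary F <= boundary X) ->
  (forall X, splitting X -> boundary X <= boundary F -> #|F| <= #|X|) ->
  boundary F <= 'C(n - k, k) ->
  v \in F -> u \in F -> v \in image_fam g F -> u \in image_fam g F -> u != v ->
  image_fam g F = F.
Proof.
move=> k0 sF m1 m2 bF vF uF vg ug uv; have /and3P[FK _ _] := sF.
have [||||<-//|[w ew _]] := atom_meet F (image_fam g F) k0 sF m1 m2 bF.
- exact: imset_perm_sub.
- exact: card_imset_perm.
- exact: card_nbhd_imset.
- by apply/set0Pn; exists v; apply/setIP.
have : v \in F :&: image_fam g F by apply/setIP.
have : u \in F :&: image_fam g F by apply/setIP.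
by rewrite ew !inE => /eqP eu /eqP ev; rewrite eu ev eqxx in uv.
Qed.

(** If [F] were independent, the neighbourhoods of two of its members would lie wholly in the
    boundary, which [two_nbrs] makes too large. *)
Lemma boundary_edge F : 2 * k <= n -> F \subset K -> 1 < #|F| -> boundary F <= 'C(n - k, k) ->
  exists A B, [/\ A \in F, B \in F & kneser_adj n A B].
Proof.
move=> nk FK F2 bF.
case: (boolP [exists A in F, exists B in F, kneser_adj n A B]).
  by case/exists_inP=> A FA /exists_inP[B FB AB]; exists A, B.
move/exists_inPn => H; move: bF; rewrite leqNgt => /negP[].
have [A [B [FA FB AB]]] := card_gt1P F2.
have [AK BK] := (subsetP FK _ FA, subsetP FK _ FB).
apply: leq_trans (two_nbrs A B nk AK BK AB) _.
apply/subset_leq_card/subsetP => C CAB; rewrite in_setD andbC.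
apply/andP; split.
  by move: C CAB; apply/subsetP; rewrite subUset !nbrs_nbhd.
apply/negP => FC; case/setUP: CAB; rewrite mem_nbrs => /andP[_ adj].
  by have /exists_inPn/(_ C FC) := H A FA; rewrite adj.
by have /exists_inPn/(_ C FC) := H B FB; rewrite adj.
Qed.

Lemma boundary_vertex F : 2 * k < n -> F \subset K -> F != K ->
  (exists A B, [/\ A \in F, B \in F & kneser_adj n A B]) ->
  exists v, [/\ v \in F, exists2 u, u \in F & u \in nbrs v &
                exists2 u, u \notin F & u \in nbrs v].
Proof.
move=> nk FK FnK [A0 [B0 [FA0 FB0 AB0]]].
(* If no vertex of [Q] had a neighbour outside [F], then [Q] would be closed under adjacency and,
   the graph being connected, contain every vertex. *)
pose Q := [set v in F | [exists u in F, u \in nbrs v]].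
case: (boolP [exists v in Q, ~~ (nbrs v \subset F)]).
  case/exists_inP=> v; rewrite in_set => /andP[Fv /exists_inP[u Fu uv]].
  by case/subsetPn=> w wv Fw; exists v; split=> //; [exists u|exists w].
move/exists_inPn => H.
have {}H v : v \in Q -> nbrs v \subset F by move/H; rewrite negbK.
have Qnbr v w : v \in Q -> w \in nbrs v -> w \in Q.
  move=> Qv wv; rewrite in_set (subsetP (H v Qv)) //=.
  apply/exists_inP; exists v; first by move: Qv; rewrite in_set => /andP[].
  have vF : v \in F by move: Qv; rewrite in_set => /andP[].
  by move: wv; rewrite !mem_nbrs kneser_sym (subsetP FK v vF) => /andP[_ ->].
have QA0 : A0 \in Q.
  rewrite in_set FA0; apply/exists_inP; exists B0 => //.
  by rewrite mem_nbrs (subsetP FK).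
have Kk A : A \in ksets setT k = (A \in K) by rewrite mem_ksets subsetT in_kverts.
case/negP: FnK; rewrite eqEsubset FK /=; apply/subsetP => B BK.
suff : B \in Q by rewrite in_set => /andP[].
apply: contraT => QB.
have A0T : A0 \in ksets setT k by rewrite Kk (subsetP FK).
have BT : B \in ksets setT k by rewrite Kk.
have [C [a [b [CK QC aC]]]] := swap_boundary _ _ _ Q A0 B A0T BT QA0 QB.
rewrite in_setD => /andP[bC _] /negP[].
have cC : #|C| = k by move: CK; rewrite Kk in_kverts => /eqP.
(* Since [2 * k < n], some [k]-set [w] avoids [b |: C]; it is a common neighbour of [C] and
   [exchange b a C]. *)
have [w [_ wbC cw]] : exists w, [/\ set0 \subset w, w \subset ~: (b |: C) & #|w| = k].
  apply: exists_kset; first exact: sub0set.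
  by rewrite cards0 cardsCs setCK card_ord cardsU1 bC cC; clear -nk; lia.
have wK : w \in K by rewrite in_kverts cw.
have adj A : A \subset b |: C -> kneser_adj n A w.
  move=> AbC; rewrite /kneser_adj disjoint_sym disjoints_subset.
  by apply: subset_trans wbC _; rewrite setCS.
have Qw : w \in Q by apply: (Qnbr C) => //; rewrite mem_nbrs wK adj // subsetUr.
apply: (Qnbr w) => //; rewrite mem_nbrs in_kverts card_exchange // cC eqxx /=.
by rewrite kneser_sym adj // setUS // subsetDl.
Qed.

Lemma kverts_disjoint_neq u v : 0 < k -> u \in K -> [disjoint u & v] -> u != v.
Proof.
rewrite in_kverts => k0 /eqP cu duv; apply: contraTneq duv => <-.
by rewrite -setI_eq0 setIid -cards_eq0 cu -lt0n.
Qed.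

Lemma no_atom F : 1 < k -> 2 * k < n -> splitting F ->
  (forall X, splitting X -> boundary F <= boundary X) ->
  (forall X, splitting X -> boundary X <= boundary F -> #|F| <= #|X|) ->
  boundary F <= 'C(n - k, k) -> False.
Proof.
move=> k1 nk sF m1 m2 bF; have k0 := ltnW k1; have /and3P[FK F2 cF2] := sF.
have FnK : F != K.
  apply: contraTneq cF2 => ->; rewrite -leqNgt.
  have -> : K :\: closed_nbhd K = set0; last by rewrite cards0.
  by apply/eqP; rewrite setD_eq0 sub_nbhd.
have [v [Fv [u0 Fu0 u0v] [u' Fu' u'v]]] :=
  boundary_vertex F nk FK FnK (boundary_edge F (ltnW nk) FK F2 bF).
(* Exchanges among the neighbours of [v] leave [F] at some step: [C] lies in [F], [exchange b a C]
   does not, and both are adjacent to [v]. *)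
have [C [a [b [Cv FC aC]]]] := swap_boundary _ _ _ F u0 u' u0v u'v Fu0 Fu'.
rewrite !inE => /andP[bC bv] FC'.
have vK := subsetP FK v Fv; have CK := subsetP FK C FC.
have cv : #|v| = k by move: vK; rewrite in_kverts => /eqP.
have cC : #|C| = k by move: CK; rewrite in_kverts => /eqP.
have Cvs : C \subset ~: v by move: Cv; rewrite mem_ksets => /andP[].
have dCv : [disjoint C & v] by rewrite disjoints_subset.
have av : a \notin v by have := subsetP Cvs a aC; rewrite inE.
have gC g : C \in F -> g @: C \in image_fam g F by move=> ?; apply: imset_f.
have fixv a1 b1 : a1 \notin v -> b1 \notin v -> v \in image_fam (tperm a1 b1) F.
  move=> /negPf a1v /negPf b1v; rewrite -[X in X \in _](imset_tperm_id _ a1 b1 v).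
    exact: imset_f.
  by rewrite a1v b1v.
have Cv_neq := kverts_disjoint_neq C v k0 CK dCv.
have C'g : exchange b a C \in image_fam (tperm a b) F.
  by rewrite -imset_tperm //; apply: imset_f.
have cbC : #|b |: C| = k.+1 by rewrite cardsU1 bC cC.
have dbC : [disjoint b |: C & v].
  by rewrite disjoints_subset subUset sub1set inE bv.
(* For n = 2k+1 two disjoint k-sets miss a single point, so permutations fixing v
   act doubly transitively on its neighbours; for larger n the two neighbours C and
   exchange b a C of v have a common neighbour that meets v. *)
have [n1|n2] := leqP n (2 * k).+1.
  have n1' : n = (2 * k).+1 by apply/eqP; rewrite eqn_leq n1.
  have evC : ~: v = b |: C.
    apply/eqP; rewrite eq_sym eqEcard -disjoints_subset dbC /=.
    by rewrite cbC cardsCs setCK card_ord cv n1'; clear; lia.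
  (* A second neighbour [u2] of [v] in [F] would be [~: v] without one point [z] of [C]. The
     transposition of [a] and [z] fixes [v] and [C], so it preserves [F], yet it sends [u2] to
     [exchange b a C]. *)
  have uniqC u2 : u2 \in F -> u2 \in nbrs v -> u2 = C.
    move=> Fu2; rewrite mem_ksets => /andP[u2v /eqP cu2].
    apply/eqP; apply: contraT => u2C.
    have /subsetPn[z zC zu2] : ~~ (C \subset u2).
      by apply: contra u2C => Cu2; rewrite eq_sym eqEcard Cu2 cC cu2 leqnn.
    have zv : z \notin v by have := subsetP Cvs z zC; rewrite inE.
    have eu2 x : x \notin v -> x != z -> x \in u2.
      move=> xv xz; have -> : u2 = ~: v :\ z.
        apply/eqP; rewrite eqEcard subsetD1 u2v zu2 /= cu2 evC.
        have := cardsD1 z (b |: C); rewrite cbC !inE zC orbT add1n => -[<-].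
        by rewrite leqnn.
      by rewrite !inE xz xv.
    have au2 : a \in u2.
      apply: contraT => au2; case/negP: FC'; suff <- : u2 = exchange b a C by [].
      apply/eqP; rewrite eqEcard card_exchange // cu2 cC leqnn andbT.
      apply/subsetP => x xu2; have : x \in ~: v by apply: (subsetP u2v).
      rewrite evC !inE => /orP[->//|xC]; rewrite xC andbT.
      by apply/orP; right; apply: contraNneq au2 => <-.
    have gF : image_fam (tperm a z) F = F.
      apply: (perm_atom F _ v C) => //; first exact: fixv.
      by rewrite -[X in X \in _](imset_tperm_id _ a z C) ?aC ?zC //; apply: imset_f.
    case/negP: FC'; rewrite -gF.
    suff <- : tperm a z @: u2 = exchange b a C by apply: imset_f.
    rewrite imset_tperm //; apply/eqP; rewrite eqEcard !card_exchange // cu2 cC leqnn andbT.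
    apply/subsetP => x; rewrite !inE => /orP[/eqP->|/andP[xa xu2]].
      by rewrite zC andbT; apply/orP; right; apply: contraNneq zu2 => ->.
    have : x \in ~: v by apply: (subsetP u2v).
    by rewrite evC !inE xa => /orP[->|->]; rewrite ?orbT.
  (* A permutation interchanging [C] and [v] also preserves [F], which makes [v] the only neighbour
     of [C] in [F]. *)
  have [g [gCv gvC]] := exists_swap_perm _ C v dCv (etrans cC (esym cv)).
  have gF : image_fam g F = F.
    apply: (perm_atom F _ v C) => //.
      by rewrite -gCv; apply: imset_f.
    by rewrite -gvC; apply: imset_f.
  have uniqv w : w \in F -> w \in nbrs C -> w = v.
    move=> Fw; rewrite mem_nbrs => /andP[wK dCw].
    apply: (@imset_inj _ _ g); first exact: perm_inj.
    rewrite gvC; apply: uniqC; first by rewrite -gF; apply: imset_f.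
    rewrite mem_nbrs in_kverts card_imset; last exact: perm_inj.
    by rewrite -in_kverts wK -gCv /kneser_adj imset_disjoint //; apply: perm_inj.
  (* The [k] other neighbours of [v] and the [k] other neighbours of [C] form disjoint sets in the
     boundary; for [k >= 2] this is more than ['C(n - k, k) = k + 1]. *)
  have sub : (nbrs v :\ C) :|: (nbrs C :\ v) \subset closed_nbhd F :\: F.
    apply/subsetP => w /setUP[] /setD1P[wn ww]; rewrite in_setD.
      rewrite (subsetP (nbrs_nbhd F v Fv)) // andbT.
      by apply: contra wn => Fw; rewrite (uniqC w).
    rewrite (subsetP (nbrs_nbhd F C FC)) // andbT.
    by apply: contra wn => Fw; rewrite (uniqv w).
  have e0 : (nbrs v :\ C) :&: (nbrs C :\ v) = set0.
    apply/eqP; rewrite -subset0; apply/subsetP => w /setIP[/setD1P[_ w1] /setD1P[_ w2]].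
    move: w1 w2; rewrite !mem_ksets => /andP[wv /eqP cw] /andP[wC _].
    have : w \subset [set b].
      apply/subsetP => x xw; have := subsetP wv x xw; have := subsetP wC x xw.
      by rewrite evC !inE => /negPf ->; rewrite orbF.
    by move/subset_leq_card; rewrite cards1 cw leqNgt k1.
  have vC : v \in nbrs C by rewrite mem_nbrs vK.
  have := leq_trans (subset_leq_card sub) bF.
  have cU := cardsUI (nbrs v :\ C) (nbrs C :\ v); rewrite e0 cards0 addn0 in cU.
  have c1 := cardsD1 C (nbrs v); rewrite Cv card_nbrs // in c1.
  have c2 := cardsD1 v (nbrs C); rewrite vC card_nbrs // in c2.
  have e : 'C(n - k, k) = k.+1.
    have -> : n - k = k.+1 by rewrite n1'; clear; lia.
    by rewrite binSn.
  have ar (u a1 b1 d : nat) : u = a1 + b1 -> d = 1 + a1 -> d = 1 + b1 -> d = k.+1 ->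
    u <= d -> False by clear -k1; lia.
  exact: ar cU c1 c2 e.
have [z] : exists z, z \in ~: ((b |: C) :|: v).
  apply/card_gt0P; rewrite cardsCs setCK card_ord subn_gt0.
  apply: leq_ltn_trans (leq_card_setU _ _) _; rewrite cbC cv addSn addnn -mul2n.
  exact: n2.
rewrite in_setC in_setU negb_or => /andP[zbC zv].
have [x xv] : exists x, x \in v by apply/card_gt0P; rewrite cv.
(* [w] is adjacent to both [C] and [exchange b a C], hence lies in both closed neighbourhoods; but
   it differs from [v] and, since [k >= 2], still meets [v]. *)
set w := exchange z x v.
have wK : w \in K by rewrite in_kverts card_exchange // cv.
have adj A : A \subset b |: C -> kneser_adj n w A.
  move=> AbC; apply: disjointWr AbC _; rewrite /kneser_adj disjoint_sym.
  rewrite disjoints_subset; apply/subsetP => y ybC; rewrite !inE negb_or negb_and.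
  rewrite (disjointFr dbC ybC) orbT andbT.
  by apply: contraNneq zbC => <-.
have [|eF|[v' ev ew]] := atom_meet F (image_fam (tperm a b) F) k0 sF m1 m2 bF
    (imset_perm_sub _ _ FK) (card_imset_perm _ _) (card_nbhd_imset _ _).
- by apply/set0Pn; exists v; rewrite inE Fv fixv.
- by case/negP: FC'; rewrite eF.
have ev' : v' = v.
  have : v \in F :&: image_fam (tperm a b) F by rewrite inE Fv fixv.
  by rewrite ev inE => /eqP.
have : w \in closed_nbhd [set v'].
  rewrite -ew inE; apply/andP; split; apply/closed_nbhdP; split=> //; right.
    by exists C; rewrite // adj // subsetUr.
  by exists (exchange b a C); rewrite // adj // setUS // subsetDl.
rewrite ev' => /closed_nbhdP[_ []].
  rewrite inE => /eqP ewv; have : z \in w by rewrite !inE eqxx.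
  by rewrite ewv (negPf zv).
have /card_gt0P[y] : 0 < #|v :\ x|.
  by have := cardsD1 x v; rewrite xv cv; case: #|_ :\ _| => // kk; rewrite kk in k1.
rewrite !inE => /andP[yx yv] [B]; rewrite inE => /eqP -> /pred0P/(_ y).
by rewrite /= !inE yx yv orbT.
Qed.

Lemma boundary_splitting F : 1 < k -> 2 * k < n -> splitting F ->
  'C(n - k, k) < boundary F.
Proof.
move=> k1 nk sF; rewrite ltnNge; apply/negP => bF.
have [F1 sF1 min1] := arg_minnP boundary sF.
have s1 : splitting F1 && (boundary F1 <= boundary F1) by rewrite sF1 leqnn.
have [F2 /andP[sF2 b2] min2] := @arg_minnP _ F1
  (fun X => splitting X && (boundary X <= boundary F1)) (fun X => #|X|) s1.
apply: (no_atom F2) => //.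
- by move=> X /min1; apply: leq_trans.
- by move=> X sX bX; apply: min2; rewrite sX (leq_trans bX).
- exact: leq_trans b2 (leq_trans (min1 F sF) bF).
Qed.

End Kneser.

(** * Components after deleting a vertex cut *)

Section Bounds.

Variables n k : nat.
Implicit Types (A B : {set 'I_n}) (F S : {set {set 'I_n}}).

Notation K := (kverts n k).

Lemma kverts_ksets : K = ksets setT k.
Proof. by apply/setP => A; rewrite mem_ksets subsetT in_kverts. Qed.

Lemma card_kverts : #|K| = 'C(n, k).
Proof. by rewrite kverts_ksets card_ksets cardsT card_ord. Qed.

Lemma card_star (x : 'I_n) : 0 < k ->
  #|[set A in K | x \in A]| = 'C(n - 1, k - 1).
Proof.
move=> k0; have x1 : #|[set x]| <= k by rewrite cards1.
have := card_ksets_sup setT [set x] k (subsetT _) x1.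
rewrite cardsT card_ord cards1 => <-; apply: eq_card => A.
by rewrite kverts_ksets !in_set sub1set.
Qed.

Lemma hilton_milner_bound_le : 0 < k -> 2 * k <= n -> hilton_milner_bound n k <= 'C(n - 1, k - 1).
Proof.
move=> k0 nk; rewrite /hilton_milner_bound.
have : 0 < 'C(n - k - 1, k - 1) by rewrite bin_gt0; lia.
have : 'C(n - k - 1, k - 1) <= 'C(n - 1, k - 1) by apply: leq_bin2l; lia.
lia.
Qed.

Lemma hilton_milner_star F : 0 < k -> 2 * k <= n -> F \subset K -> intersecting F ->
  hilton_milner_bound n k < #|F| -> exists x, {in F, forall A, x \in A}.
Proof.
move=> k0 nk FK FI cF; apply/nontrivialPn; apply: contraL cF => nt; rewrite -leqNgt.
have := hilton_milner k k0 setT F; rewrite cardsT card_ord -kverts_ksets; exact.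
Qed.

(** A family above the Hilton-Milner bound is contained in a star; otherwise that bound, which is no
    larger, applies. *)
Lemma erdos_ko_rado F : 0 < k -> 2 * k <= n -> F \subset K -> intersecting F ->
  #|F| <= 'C(n - 1, k - 1).
Proof.
move=> k0 nk FK FI; have [le|/hilton_milner_star] := leqP #|F| (hilton_milner_bound n k).
  exact: leq_trans le (hilton_milner_bound_le k0 nk).
case=> // x Fx; rewrite -(card_star x k0); apply/subset_leq_card/subsetP => A FA.
by rewrite in_set (subsetP FK) // Fx.
Qed.

Lemma kverts_neq0 A : 0 < k -> A \in K -> A != set0.
Proof. by rewrite in_kverts => k0 /eqP cA; rewrite -card_gt0 cA. Qed.

Lemma independent_intersecting F : 0 < k -> independent n k F <-> F \subset K /\ intersecting F.
Proof.
move=> k0; split=> -[FK FI]; split=> //.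
  apply/intersectingP => A B FA FB; have [<-|AB] := eqVneq A B.
    by rewrite setIid kverts_neq0 // (subsetP FK).
  by rewrite setI_eq0 FI.
by move=> A B FA FB _; rewrite /kneser_adj -setI_eq0 (intersectingP F FI).
Qed.

Lemma card_max_independent F : 0 < k -> 2 * k <= n -> independent n k F ->
  max_independent n k F <-> #|F| = 'C(n - 1, k - 1).
Proof.
move=> k0 nk Fi; split.
  case=> /(independent_intersecting F k0)[FK FI] max; apply/eqP; rewrite eqn_leq erdos_ko_rado //=.
  have n0 : 0 < n by lia.
  rewrite -(card_star (Ordinal n0)) //; apply/max/independent_intersecting => //; split.
    by apply/subsetP => A; rewrite in_set => /andP[].
  apply/intersectingP => A B; rewrite !in_set => /andP[_ xA] /andP[_ xB].
  by apply/set0Pn; exists (Ordinal n0); apply/setIP.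
by move=> cF; split=> // J /(independent_intersecting J k0)[JK JI]; rewrite cF erdos_ko_rado.
Qed.

End Bounds.

Section Components.

Variables (n k : nat) (S : {set {set 'I_n}}).
Implicit Types (A B C : {set 'I_n}) (X : {set {set 'I_n}}).

Notation K := (kverts n k).
Notation nbrs A := (ksets (~: A) k).
Notation T := (K :\: S).
Notation root := fingraph.root.
Notation e := (induced_rel n T).

Definition component_roots := [set A in T | roots e A].

Definition component A := [set B in T | root e B == root e A].

Lemma induced_connect_sym : connect_sym e.
Proof.
apply: sym_connect_sym => A B; rewrite /induced_rel /= kneser_sym.
by case: (A \in T); rewrite ?andbF.
Qed.

Lemma card_component_roots : #|component_roots| = ncomp_del n k S.
Proof. by apply: eq_card => A; rewrite [LHS]in_set andbC. Qed.

Lemma root_in A : A \in T -> root e A \in component_roots.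
Proof.
move=> TA; rewrite in_set roots_root ?andbT; last exact: induced_connect_sym.
have cl : closed e (mem T) by move=> B C /and3P[-> ->].
by rewrite -(closed_connect cl (connect_root e A)).
Qed.

Lemma component_rootsP A : A \in component_roots -> A \in T /\ root e A = A.
Proof. by rewrite in_set => /andP[TA /eqP]. Qed.

Lemma adj_root A B : A \in T -> B \in T -> kneser_adj n A B -> root e A = root e B.
Proof.
move=> TA TB AB; apply/(fingraph.rootP induced_connect_sym)/connect1.
by rewrite /induced_rel TA TB.
Qed.

Lemma transversal_intersecting X : 0 < k -> X \subset T ->
  {in X &, injective (root e)} -> intersecting X.
Proof.
move=> k0 XT inj; have XK : X \subset K by apply: subset_trans XT (subsetDl _ _).
suff /(independent_intersecting n k X k0)[] : independent n k X by [].
split=> // A B XA XB; apply: contra => AB; apply/eqP/inj => //.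
by apply: adj_root => //; apply: (subsetP XT).
Qed.

Lemma component_roots_inj : {in component_roots &, injective (root e)}.
Proof. by move=> A B /component_rootsP[_ eA] /component_rootsP[_ eB]; rewrite eA eB. Qed.

Lemma component_roots_sub : component_roots \subset T.
Proof. by apply/subsetP => A /component_rootsP[]. Qed.

Lemma ncomp_intersecting : 0 < k -> intersecting T -> ncomp_del n k S = #|T|.
Proof.
move=> k0 TI; rewrite -card_component_roots; apply/eqP.
rewrite eqn_leq subset_leq_card ?component_roots_sub //=.
apply/subset_leq_card/subsetP => A TA; suff <- : root e A = A by apply: root_in.
have /connectP[[|B p] /=] := connect_root e A; first by [].
case/andP=> /and3P[_ TB]; rewrite /kneser_adj -setI_eq0.
by rewrite (negPf (intersectingP T TI A B TA TB)).
Qed.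

Lemma many_components_intersecting : 2 <= k -> 2 * k <= n ->
  hilton_milner_bound n k < ncomp_del n k S -> intersecting T.
Proof.
move=> k1 nk big; have k0 := ltnW k1; apply/intersectingP => A B TA TB.
rewrite setI_eq0; apply/negP => AB.
have eAB := adj_root A B TA TB AB; set r := root e A in eAB.
(* Exchanging the root [r] for any [C] of its component gives another transversal of the same
   size. *)
pose P C := C |: (component_roots :\ r).
have rP : r \in component_roots by apply: root_in.
have starP C : C \in T -> root e C = r -> 
      exists2 x, x \in C & forall D : {set 'I_n}, D \in component_roots :\ r -> x \in D.
  move=> TC rC.
  have nC : C \notin component_roots :\ r.
    by apply/setD1P => -[Cr /component_rootsP[_]]; rewrite rC => eC; rewrite eC eqxx in Cr.
  have PT : P C \subset T.
    by rewrite subUset sub1set TC (subset_trans (subsetDl _ _) component_roots_sub).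
  have inj : {in P C &, injective (root e)}.
    have aux D : D \in component_roots :\ r -> root e D != root e C.
      by case/setD1P=> Dr /component_rootsP[_ ->]; rewrite rC.
    move=> D E /setU1P[->|PD] /setU1P[->|PE] //.
    - by move=> eD; have := aux E PE; rewrite -eD eqxx.
    - by move=> eD; have := aux D PD; rewrite eD eqxx.
    - by move: PD PE => /setD1P[_ PD] /setD1P[_ PE]; apply: component_roots_inj.
  have [|x Px] := hilton_milner_star n k (P C) k0 nk (subset_trans PT (subsetDl _ _))
                    (transversal_intersecting _ k0 PT inj).
    by move: big; rewrite -card_component_roots (cardsD1 r) rP cardsU1 nC.
  exists x; first by apply: Px; apply: setU11.
  by move=> D PD; apply: Px; apply: setU1r.
have [x xA xP] := starP A TA erefl.
have [y yB yP] := starP B TB (esym eAB).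
have xy : x != y by apply: contraTneq AB => exy; apply/negP => /pred0P/(_ x); rewrite /= xA exy yB.
have cxy : #|[set x; y]| = 2 by rewrite cards2 xy.
have : #|component_roots :\ r| <= 'C(n - 2, k - 2).
  have xyk : #|[set x; y]| <= k by rewrite cxy.
  have := card_ksets_sup setT [set x; y] k (subsetT _) xyk.
  rewrite cardsT card_ord cxy => <-; apply/subset_leq_card/subsetP => D PD.
  rewrite inE subUset !sub1set xP // yP // -kverts_ksets !andbT.
  by have /setD1P[_ /component_rootsP[/setDP[]]] := PD.
(* With at most [1 + 'C(n - 2, k - 2)] components, [big] would give
   ['C(n - 2, k - 1) < 'C(n - k - 1, k - 1)], against monotonicity. *)
move: big; rewrite -card_component_roots (cardsD1 r) rP /hilton_milner_bound => h1 h2.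
have := leq_trans h1 (leq_add (leqnn _) h2).
have : 'C(n - k - 1, k - 1) <= 'C(n - 2, k - 1) by apply: leq_bin2l; clear -k1; lia.
have -> : 'C(n - 1, k - 1) = 'C(n - 2, k - 1) + 'C(n - 2, k - 2).
  have -> : n - 1 = (n - 2).+1 by clear -k1 nk; lia.
  have -> : k - 1 = (k - 2).+1 by clear -k1; lia.
  by rewrite binS.
rewrite add1n addn1 ltnS ltnNge => le /negP[].
by rewrite addnC -addnBA // leq_addr.
Qed.

Lemma component_boundary A : S \subset K -> boundary n k (component A) <= #|S|.
Proof.
move=> SK; apply/subset_leq_card/subsetP => B /setDP[/closed_nbhdP[BK adj] Bc].
apply: contraT => BS; have TB : B \in T by rewrite in_setD BS.
case/negP: Bc; case: adj => // -[C]; rewrite !in_set => /andP[TC /eqP <-] BC.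
by rewrite -in_kverts BK BS (adj_root B C) ?eqxx //; rewrite in_setD in_kverts.
Qed.

Lemma component_far A B : B \in T -> root e B != root e A ->
  B \in K :\: closed_nbhd n k (component A).
Proof.
move=> TB nAB; have /setDP[BK _] := TB; rewrite in_setD BK andbT.
apply: contra nAB => /closed_nbhdP[_ [|[C]]]; first by rewrite in_set => /andP[].
by rewrite in_set => /andP[TC /eqP <-] BC; rewrite (adj_root B C).
Qed.

Lemma component1_nbrs A : 0 < k -> A \in T -> #|component A| <= 1 -> nbrs A \subset S.
Proof.
move=> k0 TA c1; apply/subsetP => B; rewrite mem_nbrs => /andP[BK AB].
apply: contraT => BS; have TB : B \in T by rewrite in_setD BS.
have cA : A \in component A by rewrite in_set TA eqxx.
have cB : B \in component A by rewrite in_set TB (adj_root A B) ?eqxx.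
have /setDP[AK _] := TA; have := kverts_disjoint_neq n k A B k0 AK AB.
by rewrite ((card_le1_eqP c1) B A cB cA) eqxx.
Qed.

(** A one-vertex component has all its neighbours in [S]; a larger one with two vertices beyond its
    neighbourhood falls under [boundary_splitting]. Among three components, either one is large and
    the other two supply the far side, or two are single vertices and [two_nbrs] gives
    strictness. *)
Lemma cut_size : 2 <= k -> 2 * k < n -> vertex_cut n k S ->
  'C(n - k, k) <= #|S| /\ (3 <= ncomp_del n k S -> 'C(n - k, k) < #|S|).
Proof.
move=> k1 nk [SK]; have k0 := ltnW k1; rewrite -card_component_roots => c2.
have big A : A \in T -> 1 < #|component A| ->
    1 < #|K :\: closed_nbhd n k (component A)| -> 'C(n - k, k) < #|S|.
  move=> TA cA fA; apply: leq_trans (component_boundary A SK).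
  apply: boundary_splitting => //; apply/and3P; split=> //.
  by apply/subsetP => B; rewrite in_set => /andP[/setDP[]].
have TK A : A \in T -> A \in K by case/setDP.
have far A B : A \in component_roots -> B \in component_roots -> A != B ->
    component B \subset K :\: closed_nbhd n k (component A).
  move=> /component_rootsP[TA rA] /component_rootsP[TB rB] AB.
  apply/subsetP => C; rewrite in_set => /andP[TC /eqP eC]; apply: component_far => //.
  by rewrite eC rA rB eq_sym.
have self A : A \in T -> A \in component A by move=> TA; rewrite in_set TA eqxx.
have single A : A \in T -> #|component A| <= 1 -> 'C(n - k, k) <= #|S|.
  move=> TA c1; rewrite -(card_nbrs n k A (TK A TA)).
  exact/subset_leq_card/component1_nbrs.
split=> [|c3].
  have [A [B [rA rB AB]]] := card_gt1P c2.
  have [[TA _] [TB _]] := (component_rootsP A rA, component_rootsP B rB).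
  have [/single|cA] := leqP #|component A| 1; first exact.
  have [/single|cB] := leqP #|component B| 1; first exact.
  apply/ltnW/(big A TA cA)/(leq_trans cB).
  exact/subset_leq_card/far.
have [A [B [C [[rA rB rC] [AB BC CA]]]]] := card_gt2P c3.
have [[TA _] [TB _]] := (component_rootsP A rA, component_rootsP B rB).
have [TC _] := component_rootsP C rC.
have two A1 B1 C1 : A1 \in component_roots -> B1 \in component_roots -> C1 \in component_roots ->
    A1 != B1 -> B1 != C1 -> C1 != A1 -> 1 < #|K :\: closed_nbhd n k (component A1)|.
  move=> rX rY rZ XY YZ ZX; apply/card_gt1P; exists B1, C1; split=> //.
    by apply: (subsetP (far A1 B1 rX rY XY)); apply/self/(component_rootsP B1 rY).1.
  apply: (subsetP (far A1 C1 rX rZ _)); first by rewrite eq_sym.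
  by apply/self; case/component_rootsP: rZ.
have [cA|cA] := leqP #|component A| 1; last exact: big (two A B C rA rB rC AB BC CA).
have [cB|cB] := leqP #|component B| 1; last exact: big (two B C A rB rC rA BC CA AB).
apply: leq_trans (two_nbrs n k A B (ltnW nk) (TK A TA) (TK B TB) AB) _.
by rewrite subset_leq_card // subUset !component1_nbrs.
Qed.

End Components.

(** * The ratio of cut size to number of components *)

Lemma ratio_nat (n k s c : nat) : 0 < k -> 0 < c -> k <= n ->
  ((n%:R / k%:R - 1 <= (s%:R / c%:R : rat))%R = ((n - k) * c <= s * k)) *
  (((s%:R / c%:R : rat)%R == (n%:R / k%:R - 1)%R) = (s * k == (n - k) * c)).
Proof.
move=> k0 c0 kn.
have kR : (0 < k%:R :> rat)%R by rewrite ltr0n.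
have cR : (0 < c%:R :> rat)%R by rewrite ltr0n.
have -> : (n%:R / k%:R - 1 = (n - k)%:R / k%:R :> rat)%R.
  by rewrite natrB // mulrBl divff // gt_eqF.
split.
  by rewrite ler_pdivrMr // mulrAC ler_pdivlMr // -!natrM ler_nat.
by rewrite eqr_div ?(gt_eqF cR) ?(gt_eqF kR) // -!natrM eqr_nat.
Qed.

Theorem theorem3p1 (n k : nat) (S : {set {set 'I_n}}) :
  3 <= k -> 2 * k + 1 <= n -> vertex_cut n k S ->
  let c := ncomp_del n k S in
  ('C(n - k - 1, k - 1) + 1 <= c <= 'C(n - 1, k - 1) - 'C(n - k - 1, k - 1) + 1)%N
  \/
  ((n%:R / k%:R - 1 <= (#|S|%:R / c%:R : rat))%R /\
   ((#|S|%:R / c%:R : rat)%R = (n%:R / k%:R - 1)%R <->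
     exists I, max_independent n k I /\ S = kverts n k :\: I)).
Proof.
rewrite addn1 => k3 nk cut c.
have k1 : 1 < k by apply: ltnW.
have k0 : 0 < k by apply: ltnW.
have nk' := ltnW nk.
have kn : k <= n by apply: leq_trans nk'; apply: leq_pmull.
have [SK c2] := cut; rewrite -/c in c2.
have c0 : 0 < c by apply: ltnW.
have [le eq] := ratio_nat n k #|S| c k0 c0 kn.
have SE : S = kverts n k :\: (kverts n k :\: S) by rewrite setDDr setDv set0U (setIidPr SK).
(* An independent remainder has [c] vertices, so [#|S| + c = 'C(n, k)]. As
   [n * 'C(n - 1, k - 1) = k * 'C(n, k)], the ratio bound becomes [c <= 'C(n - 1, k - 1)], with
   equality in both at once. *)
have indep : intersecting (kverts n k :\: S) ->
    ((n - k) * c <= #|S| * k) /\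
    ((#|S| * k == (n - k) * c) <->
     exists I, max_independent n k I /\ S = kverts n k :\: I).
  move=> TI; have TK : kverts n k :\: S \subset kverts n k := subsetDl _ _.
  have cT := ncomp_intersecting n k S k0 TI.
  have cM := erdos_ko_rado n k _ k0 nk' TK TI.
  have Ti : independent n k (kverts n k :\: S) by apply/independent_intersecting.
  have cS : #|S| + c = 'C(n, k).
    by rewrite /c cT -(card_kverts n k) -(cardsID S (kverts n k)) (setIidPr SK).
  have nM : n * 'C(n - 1, k - 1) = k * 'C(n, k).
    by rewrite !subn1 mul_bin_diag prednK.
  have eqM : (#|S| * k == (n - k) * c) = (c == 'C(n - 1, k - 1)).
    rewrite -(eqn_add2r (c * k)) -mulnDl cS mulnC -nM [c * k]mulnC -mulnDl subnK //.
    by rewrite eqn_pmul2l ?(leq_trans k0) // eq_sym.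
  split.
    rewrite -(leq_add2r (c * k)) -mulnDl cS [leqRHS]mulnC -nM [c * k]mulnC -mulnDl subnK //.
    by rewrite leq_mul2l /c cT cM orbT.
  rewrite eqM; split=> [/eqP cM'|[I [Imax SI]]].
    exists (kverts n k :\: S); split=> //.
    by apply/card_max_independent; rewrite // -cT.
  have [Ii _] := Imax; have [IK _] := Ii.
  have TI' : kverts n k :\: S = I by rewrite SI setDDr setDv set0U (setIidPr IK).
  by rewrite /c cT TI'; apply/eqP/card_max_independent.
have [cbig|csmall] := ltnP (hilton_milner_bound n k) c.
  have [le' eq'] := indep (many_components_intersecting n k S k1 nk' cbig).
  right; rewrite le le'; split=> //.
  by rewrite -eq' -eq; split=> [->|/eqP].
have [clow|chigh] := leqP c 'C(n - k - 1, k - 1); last first.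
  by left; rewrite addn1 chigh.
right; rewrite le.
have [d1 d2] := cut_size n k S k1 nk cut.
(* ['C(n - k, k) / 'C(n - k - 1, k - 1) = n / k - 1] without denominators. *)
have dk : 'C(n - k, k) * k = (n - k) * 'C(n - k - 1, k - 1).
  by rewrite !subn1 mul_bin_diag prednK // mulnC.
have lt : (n - k) * c < #|S| * k.
  have [S1|S1] := ltnP 'C(n - k, k) #|S|.
    apply: (@leq_ltn_trans ('C(n - k, k) * k)); last by rewrite ltn_pmul2r.
    by rewrite dk leq_mul2l clow orbT.
  apply: (@leq_trans ('C(n - k, k) * k)); last by rewrite leq_mul2r d1 orbT.
  rewrite dk ltn_pmul2l; last by rewrite subn_gt0; apply: leq_ltn_trans nk; apply: leq_pmull.
  (* Without strictness in [#|S|] there are at most two components, fewer than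
     ['C(n - k - 1, k - 1) >= k >= 3]. *)
  apply: (@leq_ltn_trans 2); first by rewrite leqNgt; apply: contraL S1; rewrite -ltnNge.
  apply: leq_trans k3 _.
  apply: (@leq_trans 'C(k, k - 1)); first by rewrite -bin_sub ?subKn ?bin1 // leq_subr.
  by apply: leq_bin2l; clear -nk; lia.
split; first exact: ltnW.
(* The inequality is strict here, while the complement of a maximum independent set would give
   equality: both sides of the equivalence are false. *)
split=> [/eqP|[I [Imax SI]]]; first by rewrite eq gtn_eqF.
have [[IK II] _] := Imax.
have TI : kverts n k :\: S = I by rewrite SI setDDr setDv set0U (setIidPr IK).
have TIi : intersecting (kverts n k :\: S).
  by rewrite TI; have [/(independent_intersecting n k I k0)[]] := Imax.
have [_ [_ eqI]] := indep TIi.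
by have := eqI (ex_intro _ I (conj Imax SI)); rewrite gtn_eqF.
Qed.
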